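(* Let $K$ be a smooth strictly convex body in $\mathbb{R}^n$, and let $\|\cdot\|$ be the norm on $\mathbb{R}^n$ with unit ball $B=K-K$. Then every closed (Minkowski) billiard trajectory in $K$ with respect to $\|\cdot\|$ has $\|\cdot\|$-length at least $1+\frac1n$.
   Context: A convex body is a compact convex set with nonempty interior, and $K-K=\{x-y: x\in K,\ y\in K\}$. Let $\|\cdot\|_*$ be the dual norm on $(\mathbb{R}^n)^*$; its unit ball is the polar body $B^\circ$. A closed Minkowski billiard trajectory in $K$ with respect to $\|\cdot\|$ is a closed polygonal line with vertices (bounce points) $q_1,\dots,q_m\in\partial K$, $m\ge 2$, indices modulo $m$, $q_{i+1}\neq q_i$, satisfying the following reflection rule. Let $p_i\in\partial B^\circ$ be the momentum on the segment $[q_i,q_{i+1}]$, i.e. the unique element with $\|p_i\|_*=1$ and $\langle p_i,q_{i+1}-q_i\rangle=\|q_{i+1}-q_i\|$. Then for every $i$ one has $p_{i}-p_{i-1}=-\lambda_i\, n_K(q_i)$ for some $\lambda_i>0$, where $n_K(q_i)\in(\mathbb{R}^n)^*$ is an outer normal to $K$ at $q_i$. Its length is $\sum_{i=1}^m\|q_{i+1}-q_i\|$. *)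

(* Defs.v *)
From HB Require Import structures.
From mathcomp Require Import all_boot all_order all_algebra.
From mathcomp Require Import all_classical all_reals all_analysis.

Set Implicit Arguments.
Unset Strict Implicit.
Unset Printing Implicit Defensive.

Import Order.TTheory GRing.Theory Num.Theory.
Import numFieldNormedType.Exports.

Local Open Scope classical_set_scope.
Local Open Scope ring_scope.

(* Points of R^n are row vectors, elements of the dual (R^n)^* are column
   vectors; the pairing is the entry of their 1 x 1 product. *)
Definition pairing (R : realType) (n : nat) (p : 'cV[R]_n) (x : 'rV[R]_n) : R :=
  (x *m p) ord0 ord0.

Definition boundary (T : topologicalType) (A : set T) : set T :=
  closure A `\` A°.

Definition convex_body (R : realType) (n : nat) (K : set 'rV[R]_n) : Prop :=
  [/\ compact K, convex_set K & K° !=set0].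

Definition difference_body (R : realType) (n : nat) (K : set 'rV[R]_n) :
    set 'rV[R]_n :=
  [set x - y | x in K & y in K].

Definition outer_normal (R : realType) (n : nat) (K : set 'rV[R]_n)
    (q : 'rV[R]_n) (v : 'cV[R]_n) : Prop :=
  v != 0 /\ forall x, K x -> pairing v x <= pairing v q.

(* Smooth in the sense of convex geometry: there is only one supporting
   hyperplane at each boundary point, i.e. the outer normals there form a
   single open ray. *)
Definition smooth_body (R : realType) (n : nat) (K : set 'rV[R]_n) : Prop :=
  forall q, boundary K q -> forall u v, outer_normal K q u ->
    outer_normal K q v -> exists2 c : R, 0 < c & v = c *: u.

Definition strictly_convex (R : realType) (n : nat) (K : set 'rV[R]_n) : Prop :=
  forall x y, K x -> K y -> x != y ->
  forall t : R, 0 < t -> t < 1 -> K° (t *: x + (1 - t) *: y).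

(* Nonnegativity follows from these three conditions. *)
Definition is_norm (R : realType) (n : nat) (N : 'rV[R]_n -> R) : Prop :=
  [/\ forall x, N x = 0 -> x = 0,
      forall (a : R) x, N (a *: x) = `|a| * N x &
      forall x y, N (x + y) <= N x + N y].

Definition unit_ball (R : realType) (n : nat) (N : 'rV[R]_n -> R) :
    set 'rV[R]_n :=
  [set x | N x <= 1].

Definition dual_norm (R : realType) (n : nat) (N : 'rV[R]_n -> R)
    (p : 'cV[R]_n) : R :=
  sup [set pairing p x | x in unit_ball N].

(* When the unit ball of N is smooth and v != 0, there is exactly one such p. *)
Definition is_momentum (R : realType) (n : nat) (N : 'rV[R]_n -> R)
    (v : 'rV[R]_n) (p : 'cV[R]_n) : Prop :=
  dual_norm N p = 1 /\ pairing p v = N v.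

(* Indices are modulo m: ordS and ord_pred are the cyclic successor and
   predecessor on 'I_m. *)
Definition closed_billiard_trajectory (R : realType) (n : nat)
    (K : set 'rV[R]_n) (N : 'rV[R]_n -> R) (m : nat) (q : 'I_m -> 'rV[R]_n) :
    Prop :=
  [/\ (2 <= m)%N,
      forall i, boundary K (q i),
      forall i, q (ordS i) != q i &
      exists p : 'I_m -> 'cV[R]_n,
        (forall i, is_momentum N (q (ordS i) - q i) (p i)) /\
        (forall i, exists (lambda : R) (v : 'cV[R]_n),
           [/\ 0 < lambda, outer_normal K (q i) v &
               p i - p (ord_pred i) = - (lambda *: v)])].

Definition trajectory_length (R : realType) (n : nat) (N : 'rV[R]_n -> R)
    (m : nat) (q : 'I_m -> 'rV[R]_n) : R :=
  \sum_(i < m) N (q (ordS i) - q i).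

(* Main.v *)
Require Import Defs.
From mathcomp Require Import all_boot all_order all_algebra.
From mathcomp Require Import all_classical all_reals all_analysis.
From mathcomp Require Import zify lra ring.

Set Implicit Arguments.
Unset Strict Implicit.
Unset Printing Implicit Defensive.

Import Order.TTheory GRing.Theory Num.Theory.
Import numFieldNormedType.Exports.

Local Open Scope classical_set_scope.
Local Open Scope ring_scope.

(** Write [v i] for the outer normal at the bounce point [q i] and [w i > 0] for
the factor by which it enters the momentum jump there.  The jumps telescope
around the closed trajectory, so [\sum_i w i *: v i = 0]: the normals satisfy a
linear relation with positive coefficients ([trajectory_positive_relation]).
This obstructs translation: a vector [t] moving all bounce points into the interior of [K]
would satisfy [pairing (v i) t < 0] for every [i], and the weighted sum of these
numbers is zero.

By Caratheodory's argument ([caratheodory_positive_relation]) the obstruction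
already lives on a nonempty set [S] of at most [n + 1] bounce points.  These cut
the trajectory into [#|S|] arcs.  Deleting the longest one leaves a path that
still visits all of [S] and has length at most [1 - 1/(n + 1)] times the length
of the trajectory ([short_window]).

On the other hand a path of length less than [1] can be translated into the
interior of [K] ([short_path_translate]).  Since the unit ball is [K - K], the
[e]-th edge of the path is [l e *: (a e - b e)] with [a e], [b e] in [K] and
[l e] its length.  Starting at [\sum_e l e *: b e] and following the path
replaces [b e] by [a e] for one [e] after the other, so every vertex is a
combination of points of [K] whose total weight is the length of the path; the
weight missing to reach [1] goes to an interior point of [K].

Hence the path through [S] has length at least [1], so the length [L] of the
trajectory satisfies [(1 - 1/(n + 1)) L >= 1], which is [L >= 1 + 1/n]. *)

(** * Positive relations and Caratheodory's theorem *)

(** Appending a coordinate equal to [1] to each vector makes the condition that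
the coefficients sum to zero part of an ordinary linear dependence in dimension
[n + 1]. *)
Lemma affine_dependence (R : realFieldType) (n k : nat) (v : 'I_k -> 'cV[R]_n) :
  (n.+1 < k)%N ->
  exists c : 'I_k -> R,
    [/\ exists i, c i != 0, \sum_i c i = 0 & \sum_i c i *: v i = 0].
Proof.
move=> ltnk.
pose A : 'M[R]_(k, n + 1) := \matrix_i row_mx (v i)^T 1.
have kerA : kermx A != 0.
  rewrite -mxrank_eq0 mxrank_ker -lt0n subn_gt0.
  by rewrite (leq_ltn_trans (rank_leq_col A)) // addn1.
have [i /eqP rowi] : exists i, row i (kermx A) != 0.
  apply/existsP; apply: contraNT kerA; rewrite negb_exists => /forallP k0.
  by apply/eqP/row_matrixP => i; move: (k0 i); rewrite negbK row0 => /eqP.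
have : row i (kermx A) *m A = 0 by rewrite -row_mul mulmx_ker row0.
move: (row i (kermx A)) rowi => u rowi uA.
have uE : u *m A = \sum_j u 0 j *: row_mx (v j)^T 1.
  by rewrite mulmx_sum_row; apply: eq_bigr => j _; rewrite rowK.
exists (fun j => u 0 j); split.
- have [j uj] : exists j, u 0 j != 0; last by exists j.
  apply/existsP; apply: contra_notT rowi; rewrite negb_exists => /forallP u0.
  by apply/rowP => j; rewrite mxE; apply/eqP; rewrite -[_ == _]negbK u0.
- have /matrixP/(_ 0 (rshift n 0)) := uA.
  rewrite uE summxE [RHS]mxE => E; rewrite -[RHS]E; apply: eq_bigr => j _.
  by rewrite mxE row_mxEr mxE mulr1.
- apply/colP => a; have /matrixP/(_ 0 (lshift 1 a)) := uA.
  rewrite uE summxE [RHS]mxE => E; rewrite summxE [RHS]mxE -[RHS]E.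
  by apply: eq_bigr => j _; rewrite [RHS]mxE row_mxEl !mxE.
Qed.

Definition positive_relation (R : realFieldType) (n : nat) (I : finType)
    (v : I -> 'cV[R]_n) (S : {set I}) : Prop :=
  exists2 w : I -> R, (forall i, i \in S -> 0 < w i)
                    & \sum_(i in S) w i *: v i = 0.

(** Subtract from the given coefficients the largest multiple of an affine
dependence that keeps them nonnegative: some coefficient vanishes, but not all
do, because the affine dependence leaves the sum of the coefficients
unchanged. *)
Lemma positive_relation_shrink (R : realFieldType) (n : nat) (I : finType)
    (v : I -> 'cV[R]_n) (S : {set I}) :
  (n.+1 < #|S|)%N -> positive_relation v S ->
  exists T : {set I}, [/\ T \proper S, T != finset.set0 & positive_relation v T].
Proof.
move=> ltnS [w w_gt0 wv0].
have [c [[i1 ci1] csum cv]] := affine_dependence (fun k => v (enum_val k)) ltnS.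
have [i0 ci0] : exists i, 0 < c i.
  apply/existsP; apply: contraNT ci1; rewrite negb_exists => /forallP c_le0.
  have : \sum_i - c i = 0 by rewrite sumrN csum oppr0.
  move/psumr_eq0P => /(_ _ i1 isT) /eqP; rewrite oppr_eq0; apply => i _.
  by rewrite oppr_ge0 leNgt c_le0.
pose W (i : 'I_#|S|) := w (enum_val i).
have W_gt0 i : 0 < W i by apply/w_gt0/enum_valP.
pose F i := W i / c i.
(* The index [j] minimizing [F] is the first one whose coefficient reaches zero
   as the multiple of [c] grows. *)
have /= := @arg_minP _ _ _ i0 (fun i => 0 < c i) F ci0.
case=> j cj Fmin.
have Fj : 0 < F j by rewrite divr_gt0.
pose u i := W i - F j * c i.
have u_ge0 i : 0 <= u i.
  rewrite subr_ge0; have [ci|ci] := ltrP 0 (c i).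
    by rewrite -ler_pdivlMr // Fmin.
  by rewrite (le_trans _ (ltW (W_gt0 i))) // mulr_ge0_le0 // ltW.
have uj : u j = 0 by rewrite /u /F divfK ?subrr // gt_eqF.
have usum : 0 < \sum_i u i.
  rewrite sumrB -mulr_sumr csum mulr0 subr0.
  by rewrite (bigD1 j) //= ltr_wpDr ?W_gt0 // sumr_ge0 // => i _; apply: ltW.
have uv : \sum_i u i *: v (enum_val i) = 0.
  under eq_bigr do rewrite scalerBl -scalerA.
  rewrite sumrB -scaler_sumr cv scaler0 subr0.
  by rewrite -(big_enum_val (fun i => w i *: v i)).
(* [U] carries [u] over from the enumeration of [S] to [I]; it is zero outside
   [S]. *)
pose U x := \sum_(i : 'I_#|S| | enum_val i == x) u i.
have UE i : U (enum_val i) = u i.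
  rewrite /U (eq_bigl (pred1 i)) ?big_pred1_eq // => k.
  by rewrite (inj_eq enum_val_inj).
exists [set x in S | 0 < U x]%SET; split.
- rewrite properE; apply/andP; split.
    by apply/fintype.subsetP => x; rewrite inE => /andP[].
  apply/negP => /fintype.subsetP /(_ _ (enum_valP j)).
  by rewrite inE UE uj ltxx andbF.
- apply: contraTneq usum => T0; rewrite -leNgt.
  apply: sumr_le0 => i _; rewrite leNgt; apply/negP => ui.
  by have := finset.in_set0 (enum_val i); rewrite -T0 inE UE ui enum_valP.
- exists U; first by move=> x; rewrite inE => /andP[].
  rewrite -[RHS]uv big_mkcond /=.
  transitivity (\sum_(x in S) U x *: v x).
    rewrite [RHS]big_mkcond; apply: eq_bigr => x _; rewrite inE.
    case: (boolP (x \in S)) => //= xS; case: ifPn => //.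
    rewrite -(enum_rankK_in xS xS) UE -leNgt => ule0.
    by rewrite (le_anti (introT andP (conj ule0 (u_ge0 _)))) scale0r.
  by rewrite (big_enum_val (fun x => U x *: v x)); apply: eq_bigr => i _; rewrite UE.
Qed.

Lemma caratheodory_positive_relation (R : realFieldType) (n : nat) (I : finType)
    (v : I -> 'cV[R]_n) (S : {set I}) :
  S != finset.set0 -> positive_relation v S ->
  exists T : {set I},
    [/\ T != finset.set0, (#|T| <= n.+1)%N & positive_relation v T].
Proof.
have [k] := ubnP #|S|; elim: k S => // k IHk S leSk S0 Sv.
have [leS|ltS] := leqP #|S| n.+1; first by exists S.
have [T [TS T0 Tv]] := positive_relation_shrink ltS Sv.
by apply: (IHk T) => //; have := proper_card TS; lia.
Qed.

(** * Windows of a periodic sequence *)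

Lemma sum_nat_concat (V : nmodType) (f : nat -> V) (s : nat -> nat) (k : nat) :
  (forall j, (j < k)%N -> (s j <= s j.+1)%N) ->
  \sum_(j < k) \sum_(s j <= e < s j.+1) f e = \sum_(s 0%N <= e < s k) f e.
Proof.
elim: k => [|k IHk] smono; first by rewrite big_ord0 big_geq.
have s0k : forall j, (j <= k)%N -> (s 0%N <= s j)%N.
  elim=> // j IHj ltjk; apply: leq_trans (IHj (ltnW ltjk)) _.
  by apply: smono; lia.
rewrite big_ord_recr /= IHk => [|j ltjk]; last by apply: smono; lia.
by rewrite [RHS](@big_cat_nat _ _ _ (s k)) ?s0k ?smono.
Qed.

Lemma sum_nat_period (V : nmodType) (f : nat -> V) (m a : nat) :
  (forall e, f (e + m)%N = f e) ->
  \sum_(a <= e < a + m) f e = \sum_(e < m) f e.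
Proof.
move=> fm; elim: a => [|a <-]; first by rewrite add0n big_mkord.
case: m fm => [|m] fm; first by rewrite !big_geq //; lia.
rewrite addSn big_nat_recr /=; last by lia.
by rewrite fm addrC -big_ltn //; lia.
Qed.

(** The elements of [S] cut the cycle of length [m] into [#|S|] arcs, and the
largest arc sum is at least the average.  The window is the complement of that
arc: it runs from the end of the arc to its beginning one period later.  Its end
points are elements of [S] modulo [m], which is why the membership condition includes the
index [b] although the sum stops before it: a path with edges [a] to [b - 1] has
vertices [a] to [b]. *)
Lemma short_window (R : realFieldType) (m : nat) (S : {set 'I_m})
    (f : nat -> R) :
  (forall e, f (e + m)%N = f e) -> S != finset.set0 ->
  exists a b : nat,
    [/\ (a <= b)%N,
        forall i, i \in S -> exists2 e, (a <= e <= b)%N & e = i %[mod m] &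
        \sum_(a <= e < b) f e <= (1 - #|S|%:R^-1) * \sum_(e < m) f e].
Proof.
move=> fm S0.
pose l := [seq val i | i <- enum S].
have sl : size l = #|S| by rewrite size_map cardE.
have k_gt0 : (0 < #|S|)%N by rewrite card_gt0.
have l_sorted : sorted ltn l.
  rewrite /l /enum_mem -enumT; apply: (subseq_sorted ltn_trans (s2 := iota 0 m)).
    by rewrite -val_enum_ord; apply/map_subseq/filter_subseq.
  exact: iota_ltn_sorted.
have l_lt j : (j < #|S|)%N -> (nth 0 l j < m)%N.
  rewrite -sl => ltj; have /mapP[i _ ->] := mem_nth 0%N ltj; exact: ltn_ord.
have l_le i j : (i <= j)%N -> (j < #|S|)%N -> (nth 0 l i <= nth 0 l j)%N.
  move=> leij ltj; apply: (sorted_leq_nth leq_trans leqnn) => //.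
  - by apply: sub_sorted l_sorted => x y /ltnW.
  - by rewrite inE sl; lia.
  - by rewrite inE sl.
(* [s] lists the elements of [S] in increasing order, followed by the first one
   shifted by a period, so that consecutive values delimit all the arcs. *)
pose s j := if (j < #|S|)%N then nth 0%N l j else (nth 0 l 0 + m)%N.
have s_mono j : (j < #|S|)%N -> (s j <= s j.+1)%N.
  move=> ltj; rewrite /s ltj; case: ifP => ltj1; first exact: l_le.
  by have := l_lt _ ltj; lia.
have s0 : s 0%N = nth 0%N l 0 by rewrite /s k_gt0.
have sk : s #|S| = (s 0%N + m)%N by rewrite s0 /s ltnn.
pose A j := \sum_(s j <= e < s j.+1) f e.
set L := \sum_(e < m) f e.
have sumA : \sum_(j < #|S|) A j = L.
  by rewrite (sum_nat_concat f s_mono) sk sum_nat_period.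
have [j Aj] : exists j : 'I_#|S|, L / #|S|%:R <= A j.
  apply/existsP; apply: contraT; rewrite negb_exists => /forallP Alt.
  have : \sum_(j < #|S|) A j < \sum_(j < #|S|) L / #|S|%:R.
    apply: ltr_sum => [|j _]; last by rewrite ltNge Alt.
    by apply/hasP; exists (Ordinal k_gt0) => //; rewrite mem_index_enum.
  rewrite sumA sumr_const card_ord -[ltRHS]mulr_natr divfK ?ltxx //.
  by rewrite pnatr_eq0 -lt0n.
have ltj := ltn_ord j.
have sjm : (s j.+1 <= s j + m)%N.
  rewrite {2}/s ltj /s; case: ifP => ltj1; first by have := l_lt _ ltj1; lia.
  by rewrite leq_add2r l_le.
exists (s j.+1), (s j + m)%N; split => //.
- move=> i iS; have il : val i \in l by apply: map_f; rewrite mem_enum.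
  pose a := index (val i) l.
  have lta : (a < #|S|)%N by rewrite -sl index_mem.
  have ia : nth 0%N l a = i by rewrite nth_index.
  (* Elements up to [s j] are met in the next period, the others in this one. *)
  have [leaj|ltja] := leqP a j.
    exists (i + m)%N; last by rewrite modnDr.
    rewrite /s ltj leq_add2r -ia l_le // andbT.
    case: ifP => ltj1; first by have := l_lt _ ltj1; lia.
    by rewrite leq_add2r l_le.
  exists (val i) => //; rewrite -[X in (_ <= X <= _)%N]ia /s ltj.
  have -> : (j.+1 < #|S|)%N by lia.
  by rewrite l_le //=; have := l_lt _ lta; lia.
- have := sum_nat_period (s j) fm; rewrite -/L.
  rewrite (@big_cat_nat _ _ _ (s j.+1)) ?s_mono //= -/(A j) => LE.
  rewrite mulrBl mul1r [_^-1 * _]mulrC -[X in X - _]LE.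
  by rewrite -/L; lra.
Qed.

(** * The pairing of the space with its dual *)

Section Pairing.
Context {R : realType} {n : nat}.
Implicit Types (p : 'cV[R]_n) (x y : 'rV[R]_n).

Lemma pairingDr p x y : pairing p (x + y) = pairing p x + pairing p y.
Proof. by rewrite /pairing mulmxDl mxE. Qed.

Lemma pairingNr p x : pairing p (- x) = - pairing p x.
Proof. by rewrite /pairing mulNmx mxE. Qed.

Lemma pairingZr p (a : R) x : pairing p (a *: x) = a * pairing p x.
Proof. by rewrite /pairing -scalemxAl mxE. Qed.

Lemma pairing_sumr p (I : Type) (r : seq I) (P : pred I) (F : I -> 'rV[R]_n) :
  pairing p (\sum_(i <- r | P i) F i) = \sum_(i <- r | P i) pairing p (F i).
Proof. by rewrite /pairing mulmx_suml summxE. Qed.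

Lemma pairing_suml (I : finType) (P : pred I) (w : I -> R) (F : I -> 'cV[R]_n) x :
  pairing (\sum_(i | P i) w i *: F i) x = \sum_(i | P i) w i * pairing (F i) x.
Proof.
rewrite /pairing mulmx_sumr summxE; apply: eq_bigr => i _.
by rewrite -scalemxAr mxE.
Qed.

Lemma pairing_trmx_gt0 p : p != 0 -> 0 < pairing p p^T.
Proof.
move=> p0; have [i pi] : exists i, p i ord0 != 0.
  apply/existsP; apply: contraNT p0; rewrite negb_exists => /forallP p0.
  by apply/eqP/colP => i; rewrite mxE; apply/eqP; rewrite -[_ == _]negbK p0.
rewrite /pairing mxE (bigD1 i) //= mxE ltr_wpDr //.
  by apply: sumr_ge0 => j _; rewrite mxE -expr2 sqr_ge0.
by rewrite -expr2 exprn_even_gt0.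
Qed.

End Pairing.

(** A point where a nonzero functional attains its bound on [K] cannot be
interior: moving it a little in the direction [v^T] stays in [K] and increases
the functional. *)
Lemma pairing_interior_lt (R : realType) (n : nat) (K : set 'rV[R]_n)
    (v : 'cV[R]_n) (h : R) (z : 'rV[R]_n) :
  v != 0 -> (forall x, K x -> pairing v x <= h) -> K° z -> pairing v z < h.
Proof.
move=> v0 hK Kz.
have cvz : (fun e : R => z + e *: v^T) @ (0 : R) --> z.
  rewrite -[X in _ --> X]addr0 -(scale0r v^T).
  apply: cvgD; first exact: cvg_cst.
  apply: cvgZl; exact: cvg_id.
have /nbhs_ballP[r /= r0 Kr] := cvz _ Kz.
have Kr2 : K (z + (r / 2) *: v^T).
  apply: Kr; rewrite /ball /= sub0r normrN ger0_norm; last by rewrite divr_ge0 // ltW.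
  by rewrite ltr_pdivrMr // ltr_pMr // ltr1n.
apply: lt_le_trans (hK _ Kr2).
rewrite pairingDr pairingZr ltrDl mulr_gt0 ?pairing_trmx_gt0 //.
by rewrite divr_gt0.
Qed.

(** * Short paths fit into the interior *)

Lemma is_norm_ge0 (R : realType) (n : nat) (N : 'rV[R]_n -> R) x :
  is_norm N -> 0 <= N x.
Proof.
case=> _ NZ ND.
have := ND x (- x); rewrite subrr -scaleN1r NZ normrN1 mul1r.
by rewrite -[X in N X <= _](scale0r 0) NZ normr0 mul0r; lra.
Qed.

(** This is where the choice of [K - K] as unit ball enters: every segment of
length [1] is, up to translation, a segment with both end points in [K]. *)
Lemma difference_body_scale (R : realType) (n : nat) (K : set 'rV[R]_n)
    (N : 'rV[R]_n -> R) (d : 'rV[R]_n) :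
  K !=set0 -> is_norm N -> unit_ball N = difference_body K ->
  exists a b, [/\ K a, K b & d = N d *: (a - b)].
Proof.
move=> [z Kz] Nn NK; have [N0 NZ _] := Nn.
have [Nd0|Nd0] := eqVneq (N d) 0.
  by exists z, z; rewrite Nd0 scale0r (N0 d).
have : unit_ball N ((N d)^-1 *: d).
  by rewrite /unit_ball /= NZ normfV ger0_norm ?is_norm_ge0 // mulVf.
rewrite NK => -[a Ka [b Kb abE]]; exists a, b; split=> //.
by rewrite abE scalerA mulfV // scale1r.
Qed.

(** The conclusion says that the translated vertices lie strictly inside every
closed half-space containing [K], which is how membership in the interior of a
convex body is used against outer normals. *)
Lemma short_path_translate (R : realType) (n : nat) (K : set 'rV[R]_n)
    (N : 'rV[R]_n -> R) (y : nat -> 'rV[R]_n) (a b : nat) :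
  K° !=set0 -> is_norm N -> unit_ball N = difference_body K -> (a <= b)%N ->
  \sum_(a <= e < b) N (y e.+1 - y e) < 1 ->
  exists t, forall k v h, (a <= k <= b)%N -> v != 0 ->
    (forall x, K x -> pairing v x <= h) -> pairing v (y k + t) < h.
Proof.
move=> [z Kz] Nn NK leab.
pose l e := N (y e.+1 - y e).
rewrite -/(\sum_(a <= e < b) l e); set L := \sum_(_ <= _ < _) _ => L_lt1.
have l_ge0 e : 0 <= l e by exact: is_norm_ge0.
have K0 : K !=set0 by exists z; exact: interior_subset.
have /choice[c cP] : forall e, exists c : 'rV[R]_n * 'rV[R]_n,
    [/\ K c.1, K c.2 & y e.+1 - y e = l e *: (c.1 - c.2)].
  move=> e; have [a' [b' ?]] := difference_body_scale (y e.+1 - y e) K0 Nn NK.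
  by exists (a', b').
(* This sends the vertex [y a] to the combination in which every edge still
   contributes its starting point in [K]. *)
exists ((1 - L) *: z + \sum_(a <= e < b) l e *: (c e).2 - y a).
move=> k v h /andP[leak lekb] v0 hK.
(* At the vertex [y k] the edges before [k] contribute the first point [(c e).1]
   and the remaining ones the second point [(c e).2]. *)
have -> : y k + ((1 - L) *: z + \sum_(a <= e < b) l e *: (c e).2 - y a) =
  (1 - L) *: z + (\sum_(a <= e < k) l e *: (c e).1
                 + \sum_(k <= e < b) l e *: (c e).2).
  have : \sum_(a <= e < k) l e *: (c e).1
         - \sum_(a <= e < k) l e *: (c e).2 = y k - y a.
    rewrite -sumrB -telescope_sumr //; apply: eq_bigr => e _.
    by have [_ _ ->] := cP e; rewrite scalerBr.
  rewrite (@big_cat_nat _ _ _ k a b) //=.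
  move=> /eqP; rewrite subr_eq => /eqP ->.
  by rewrite -!addrA [LHS]addrCA; congr (_ + (_ + _)); rewrite addrA addrC.
have sum_le (F : nat -> 'rV[R]_n) i j : (forall e, K (F e)) ->
    pairing v (\sum_(i <= e < j) l e *: F e) <= (\sum_(i <= e < j) l e) * h.
  move=> KF; rewrite pairing_sumr mulr_suml; apply: ler_sum => e _.
  by rewrite pairingZr ler_wpM2l // hK.
have le1 := sum_le (fun e => (c e).1) a k (fun e => let: And3 H _ _ := cP e in H).
have le2 := sum_le (fun e => (c e).2) k b (fun e => let: And3 _ H _ := cP e in H).
have LE : L = \sum_(a <= e < k) l e + \sum_(k <= e < b) l e.
  by rewrite /L (@big_cat_nat _ _ _ k).
rewrite !pairingDr pairingZr.
have := pairing_interior_lt v0 hK Kz.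
rewrite -(@ltr_pM2l _ (1 - L)) ?subr_gt0 // => lt3.
move: lt3 le1 le2; rewrite LE; lra.
Qed.

(** * Billiard trajectories *)

(** The reflection rule writes each normal, up to a positive factor, as a
difference of consecutive momenta, and these differences sum to zero around a
closed trajectory. *)
Lemma trajectory_positive_relation (R : realType) (n : nat) (K : set 'rV[R]_n)
    (N : 'rV[R]_n -> R) (m : nat) (q : 'I_m -> 'rV[R]_n) :
  closed_billiard_trajectory K N q ->
  exists2 v : 'I_m -> 'cV[R]_n,
    (forall i, outer_normal K (q i) (v i)) & positive_relation v [set: 'I_m]%SET.
Proof.
case=> _ _ _ [p [_ refl]].
have /choice[c cP] : forall i, exists c : R * 'cV[R]_n, [/\ 0 < c.1,
    outer_normal K (q i) c.2 & p i - p (ord_pred i) = - (c.1 *: c.2)].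
  by move=> i; have [l [v ?]] := refl i; exists (l, v).
exists (fun i => (c i).2); first by move=> i; have [] := cP i.
exists (fun i => (c i).1); first by move=> i _; have [] := cP i.
rewrite (eq_bigl predT) => [|i]; last by rewrite finset.in_setT.
apply/eqP; rewrite -oppr_eq0 -sumrN; apply/eqP.
under eq_bigr => i _ do have [_ _ <-] := cP i.
rewrite sumrB [X in _ - X](reindex_inj (@ordS_inj m)).
by under [X in _ - X]eq_bigr do rewrite ordSK; rewrite subrr.
Qed.

Unset Implicit Arguments.

Theorem theorem3p6 (R : realType) (n : nat) (K : set 'rV[R]_n)
    (N : 'rV[R]_n -> R) (m : nat) (q : 'I_m -> 'rV[R]_n) :
  (0 < n)%N ->
  convex_body K -> smooth_body K -> strictly_convex K ->
  is_norm N -> unit_ball N = difference_body K ->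
  closed_billiard_trajectory K N q ->
  1 + n%:R^-1 <= trajectory_length N q.
Proof.
move=> n0 [_ _ K0] _ _ Nn NK traj.
have [v vK vrel] := trajectory_positive_relation traj.
case: m q traj v vK vrel => [|m] q traj v vK vrel; first by case: traj.
have T0 : [set: 'I_m.+1]%SET != finset.set0.
  by apply/set0Pn; exists ord0; rewrite finset.in_setT.
have [S [S0 Sn [w w_gt0 wv]]] := caratheodory_positive_relation T0 vrel.
(* The vertices are indexed by all natural numbers, with period the number of
   bounces, so that a path may run past the last index. *)
pose y (e : nat) := q (inord (e %% m.+1)).
have yE (i : 'I_m.+1) e : e = i %[mod m.+1] -> y e = q i.
  by move=> ei; rewrite /y ei modn_small // inord_val.
have yS (i : 'I_m.+1) : y i.+1 = q (ordS i) by apply: yE; rewrite /= modn_mod.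
have lenE : trajectory_length N q = \sum_(e < m.+1) N (y e.+1 - y e).
  by apply: eq_bigr => i _; rewrite yS (yE i).
have [|a [b [leab cover]]] := @short_window R _ S (fun e => N (y e.+1 - y e)) _ S0.
  by move=> e; rewrite /y -addSn !modnDr.
rewrite -lenE; set L := trajectory_length _ _ => window.
rewrite leNgt; apply/negP => L_lt.
have path_lt1 : \sum_(a <= e < b) N (y e.+1 - y e) < 1.
  have L_ge0 : 0 <= L by apply: sumr_ge0 => i _; exact: is_norm_ge0.
  apply: le_lt_trans window _.
  apply: (@le_lt_trans _ _ ((1 - n.+1%:R^-1) * L)).
    rewrite ler_wpM2r // lerD2l lerN2 lef_pV2 ?ler_nat // posrE ltr0n //.
    by rewrite card_gt0.
  have nR : 0 < n%:R :> R by rewrite ltr0n.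
  have -> : 1 - n.+1%:R^-1 = (1 + n%:R^-1)^-1 :> R.
    rewrite -natr1; clear -nR; field.
    by rewrite !gt_eqF ?addr_gt0.
  by rewrite mulrC ltr_pdivrMr ?mul1r // addr_gt0 // invr_gt0.
have [t tP] := short_path_translate K0 Nn NK leab path_lt1.
have vt i : i \in S -> pairing (v i) t < 0.
  move=> iS; have [e eab /yE yei] := cover i iS.
  have [vi0 vi] := vK i.
  by have := tP e _ _ eab vi0 vi; rewrite yei pairingDr gtrDl.
have [i iS] := set0Pn _ S0.
have : \sum_(j in S) w j * pairing (v j) t < 0.
  rewrite (bigD1 i) //= ltr_nwDl //; first by rewrite pmulr_rlt0 ?w_gt0 ?vt.
  by apply: sumr_le0 => j /andP[jS _]; rewrite pmulr_rle0 ?w_gt0 // ltW // vt.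
by rewrite -pairing_suml wv /pairing mulmx0 mxE ltxx.
Qed.
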